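(* Assume Martin's Axiom. Then there is a filter $F\subset LF\setminus IF$ (a filter of the lattice $LF$ containing no finite group) such that for every $(\mathbf{\Sigma}^1_1\cup\mathbf{\Pi}^1_1)$-coloring $\delta: LF\to 2$ there is $G\in F$ such that $\delta$ is constant on the set of all infinite subgroups of $G$.
   Context: $SF(\omega)$ is the group of all finitary (finite support) permutations of $\omega$; $LF$ is the lattice of all subgroups of $SF(\omega)$ ordered by inclusion; $IF$ is the ideal of all finite subgroups. Topology on $LF$: for a finite set $A\subset\omega$ and a finite group $H\le SF(\omega)$ all of whose elements have support contained in $A$, let $[H,A]$ be the set of all $G\in LF$ such that the group induced by $G$ on $A$ equals $H$ (viewed as a permutation group on $A$); here the group induced by $G$ on $A$ is $\{g\in G: supp(g)\subset A\}$. The sets $[H,A]$ form a base of the topology. It is metrizable and complete: with $A_0,A_1,\dots$ an enumeration of all finite subsets of $\omega$, a metric is $d(G_1,G_2)=\sum\{2^{-n}:\text{the groups induced by }G_1\text{ and }G_2\text{ on }A_n\text{ are different}\}$. A function $\delta: LF\to 2=\{0,1\}$ is a $(\mathbf{\Sigma}^1_1\cup\mathbf{\Pi}^1_1)$-coloring if for each $i<2$ the set $\delta^{-1}(i)$ is analytic or coanalytic in $LF$. *)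

(* Defs.v *)
From HB Require Import structures.
From mathcomp Require Import all_boot all_order all_algebra.
From mathcomp Require Import all_classical all_reals all_analysis.

Set Implicit Arguments.
Unset Strict Implicit.
Unset Printing Implicit Defensive.

Import Order.TTheory.

Local Open Scope classical_set_scope.
Local Open Scope card_scope.
Local Open Scope group_scope.

Definition fun_supp (f : nat -> nat) : set nat := [set n | f n <> n].

Definition finitary (f : nat -> nat) : Prop :=
  bijective f /\ finite_set (fun_supp f).

Record SF := MkSF { SF_fun :> nat -> nat; SF_finitary : `[< finitary SF_fun >] }.

HB.instance Definition _ := [isSub for SF_fun].
HB.instance Definition _ := [Choice of SF by <:].

Definition supp (g : SF) : set nat := fun_supp g.

Lemma SFP (g : SF) : finitary g.
Proof. exact/asboolP/SF_finitary. Qed.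

Lemma SF_ext (g h : SF) : (forall n, g n = h n) -> g = h.
Proof. by move=> gh; apply: val_inj; apply/funext. Qed.

Lemma finitary_id : finitary id.
Proof.
split; first by exists id.
by rewrite (_ : fun_supp _ = set0)// -subset0 => n /=; exact.
Qed.

Lemma finitary_comp (g h : SF) : finitary (g \o h).
Proof.
have [[bg fg] [bh fh]] := (SFP g, SFP h); split; first exact: bij_comp.
apply: sub_finite_set (_ : _ `<=` supp g `|` supp h) _; last first.
  by rewrite finite_setU.
move=> n /= ghn; have [hn|] := pselect (h n = n); last by right.
by left => gn; apply: ghn; rewrite /= hn.
Qed.

Definition fun_inv (f : nat -> nat) (n : nat) : nat := xget 0 [set m | f m = n].

Lemma fun_invK (g : SF) : cancel (fun_inv g) g.
Proof.
move=> n; have [[g' _ g'K] _] := SFP g.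
by apply: (@xgetPex _ 0 [set m | g m = n]); exists (g' n).
Qed.

Lemma fun_funK (g : SF) : cancel g (fun_inv g).
Proof. by move=> n; have [/bij_inj inj _] := SFP g; apply/inj/fun_invK. Qed.

Lemma finitary_inv (g : SF) : finitary (fun_inv g).
Proof.
split; first by exists g; [exact: fun_invK|exact: fun_funK].
apply: sub_finite_set (SFP g).2 => n /= + gn; apply.
by rewrite -[X in fun_inv _ X]gn fun_funK.
Qed.

Definition SF_one : SF := MkSF (asboolT finitary_id).
Definition SF_mul (g h : SF) : SF := MkSF (asboolT (finitary_comp g h)).
Definition SF_inv (g : SF) : SF := MkSF (asboolT (finitary_inv g)).

Lemma SF_mulA : associative SF_mul. Proof. by move=> *; exact: SF_ext. Qed.
Lemma SF_mul1 : left_id SF_one SF_mul. Proof. by move=> *; exact: SF_ext. Qed.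
Lemma SF_1mul : right_id SF_one SF_mul. Proof. by move=> *; exact: SF_ext. Qed.
Lemma SF_mulV : left_inverse SF_one SF_inv SF_mul.
Proof. by move=> g; apply: SF_ext => n /=; rewrite fun_funK. Qed.
Lemma SF_Vmul : right_inverse SF_one SF_inv SF_mul.
Proof. by move=> g; apply: SF_ext => n /=; rewrite fun_invK. Qed.

HB.instance Definition _ :=
  isGroup.Build SF SF_mulA SF_mul1 SF_1mul SF_mulV SF_Vmul.

Definition is_subgroup (G : set SF) : Prop :=
  [/\ G 1, forall x y, G x -> G y -> G (x * y) & forall x, G x -> G x^-1].

Record LF := MkLF { LF_set :> set SF; LF_subgroup : `[< is_subgroup LF_set >] }.

HB.instance Definition _ := [isSub for LF_set].
HB.instance Definition _ := [Choice of LF by <:].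

Lemma LFP (G : LF) : is_subgroup G.
Proof. exact/asboolP/LF_subgroup. Qed.

Lemma LF_ext (G H : LF) : (G : set SF) = H -> G = H.
Proof. exact: val_inj. Qed.

Lemma trivial_subgroup : is_subgroup [set 1].
Proof.
by split => // [x y -> ->|x ->] /=; rewrite ?mulg1 ?invg1.
Qed.

HB.instance Definition _ := isPointed.Build LF (MkLF (asboolT trivial_subgroup)).

Fact LF_display : Order.disp_t. Proof. exact: Order.Disp tt tt. Qed.

Definition LF_le (G H : LF) : bool := `[< G `<=` H >].

Lemma LF_le_refl : reflexive LF_le.
Proof. by move=> G; apply/asboolP. Qed.

Lemma LF_le_anti : antisymmetric LF_le.
Proof.
by move=> G H /andP[/asboolP GH /asboolP HG]; apply/LF_ext/seteqP.
Qed.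

Lemma LF_le_trans : transitive LF_le.
Proof.
by move=> G H K /asboolP HG /asboolP GK; apply/asboolP; exact: subset_trans GK.
Qed.

HB.instance Definition _ :=
  Order.Le_isPOrder.Build LF_display LF LF_le_refl LF_le_anti LF_le_trans.

Lemma LF_leP (G H : LF) : reflect (G `<=` H) (G <= H)%O.
Proof. exact: asboolP. Qed.

Lemma subgroupI (G H : LF) : is_subgroup (G `&` H).
Proof.
have [[G1 GM GV] [H1 HM HV]] := (LFP G, LFP H); split => //.
- by move=> x y [? ?] [? ?]; split; [exact: GM|exact: HM].
- by move=> x [? ?]; split; [exact: GV|exact: HV].
Qed.

Lemma subgroup_bigcap (P : set LF) : is_subgroup (\bigcap_(K in P) K).
Proof.
split => [K _|x y Gx Gy K PK|x Gx K PK]; have [K1 KM KV] := LFP K => //.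
- by apply: KM; [exact: Gx|exact: Gy].
- by apply: KV; exact: Gx.
Qed.

Definition LF_meet (G H : LF) : LF := MkLF (asboolT (subgroupI G H)).

Definition LF_join (G H : LF) : LF :=
  MkLF (asboolT (subgroup_bigcap [set K : LF | G `|` H `<=` K])).

Lemma LF_meetP (G H K : LF) :
  (G <= LF_meet H K)%O = (G <= H)%O && (G <= K)%O.
Proof.
apply/LF_leP/andP => [GHK|[/LF_leP GH /LF_leP GK]].
  by split; apply/LF_leP => x /GHK[].
by move=> x Gx; split; [exact: GH|exact: GK].
Qed.

Lemma LF_joinP (G H K : LF) :
  (LF_join G H <= K)%O = (G <= K)%O && (H <= K)%O.
Proof.
apply/LF_leP/andP => [GHK|[/LF_leP GK /LF_leP HK]].
  split; apply/LF_leP => x Gx; apply: GHK => L /= GHL; apply: GHL;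
    by [left|right].
by move=> x /(_ K); apply => y [/GK|/HK].
Qed.

HB.instance Definition _ :=
  Order.POrder_MeetJoin_isLattice.Build LF_display LF LF_meetP LF_joinP.

Definition IF : set LF := [set G | finite_set G].

Lemma induced_subgroup (G : LF) (A : set nat) :
  is_subgroup [set g : SF | LF_set G g /\ supp g `<=` A].
Proof.
have [G1 GM GV] := LFP G; split => [|x y [Gx xA] [Gy yA]|x [Gx xA]].
- by split => // n; exact.
- split; first exact: GM.
  move=> n xyn; have [yn|] := pselect (y n = n); last exact: yA.
  by apply: xA => xn; apply: xyn; rewrite /= yn.
- split; first exact: GV.
  move=> n xn; apply: xA => xnn; apply: xn.
  by rewrite /= -[X in fun_inv _ X]xnn fun_funK.
Qed.

(* Permutations of A are identified with the elements of SF supported in A. *)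
Definition induced (G : LF) (A : set nat) : LF :=
  MkLF (asboolT (induced_subgroup G A)).

Definition LF_base_index : set (LF * set nat) :=
  [set HA | [/\ finite_set HA.2, IF HA.1 &
                forall h, LF_set HA.1 h -> supp h `<=` HA.2]].

(* The paper's [H, A], for HA = (H, A). *)
Definition LF_base (HA : LF * set nat) : set LF :=
  [set G | induced G HA.2 = HA.1].

Lemma finite_supported (A : set nat) :
  finite_set A -> finite_set [set g : SF | supp g `<=` A].
Proof.
move=> fA; have [N AN] : exists N, forall n, A n -> (n <= N)%N.
  case/finite_seqP: fA => s ->; exists (\max_(i <- s) i) => n /= ns.
  exact: (leq_bigmax_seq (P := xpredT) (F := id)).
pose f (g : SF) : {ffun 'I_N.+1 -> 'I_N.+1} := [ffun i => inord (g (val i))].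
have out (g : SF) n : supp g `<=` A -> (N < n)%N -> g n = n.
  move=> gA Nn; apply: contrapT => /gA /AN.
  by rewrite leqNgt Nn.
have ltg (g : SF) n : supp g `<=` A -> (n <= N)%N -> (g n < N.+1)%N.
  move=> gA nN; rewrite ltnS leqNgt; apply/negP => Ngn.
  have /bij_inj inj := (SFP g).1.
  by have /inj gnn := out g _ gA Ngn; rewrite gnn ltnNge nN in Ngn.
have injf : {in [set g : SF | supp g `<=` A] &, injective f}.
  move=> g h /set_mem /= gA /set_mem /= hA fgh; apply: SF_ext => n.
  have [nN|Nn] := leqP n N; last by rewrite !out.
  have := congr1 (fun u : {ffun 'I_N.+1 -> 'I_N.+1} => nat_of_ord (u (inord n))) fgh.
  by rewrite /f !ffunE /= !inordK ?ltnS//; apply: ltg.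
by rewrite -(eq_finite_set (inj_card_eq injf)); exact: finite_finset.
Qed.

Lemma LF_base_index_induced (G : LF) (A : set nat) :
  finite_set A -> LF_base_index (induced G A, A).
Proof.
move=> fA; split => //=; last by move=> h [].
by apply: sub_finite_set (finite_supported fA) => g [].
Qed.

Lemma LF_base_cover : \bigcup_(HA in LF_base_index) LF_base HA = setT.
Proof.
apply/seteqP; split => // G _; exists (induced G set0, set0) => //.
exact: LF_base_index_induced.
Qed.

Lemma LF_base_join (HA KB : LF * set nat) (G : LF) :
  LF_base_index HA -> LF_base_index KB -> LF_base HA G -> LF_base KB G ->
  exists LC, [/\ LF_base_index LC, LF_base LC G &
                 LF_base LC `<=` LF_base HA `&` LF_base KB].
Proof.
case: HA KB => [H A] [K B] [/= fA _ _] [/= fB _ _] GH GK.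
exists (induced G (A `|` B), A `|` B); split => //.
  by apply: LF_base_index_induced; rewrite finite_setU.
move=> G' G'G.
have sub (C : set nat) : C `<=` A `|` B -> induced G' C = induced G C.
  move=> CAB; apply/LF_ext/seteqP; split => g /= [Gg gC]; split => //.
    have : LF_set (induced G' (A `|` B)) g by split => //; exact: subset_trans CAB.
    by rewrite G'G => -[].
  have : LF_set (induced G (A `|` B)) g by split => //; exact: subset_trans CAB.
  by rewrite -[induced G _]G'G => -[].
split; rewrite /LF_base /= sub; [exact: GH|exact: subsetUl|exact: GK|exact: subsetUr].
Qed.

HB.instance Definition _ :=
  isBaseTopological.Build LF LF_base_cover LF_base_join.

Definition baire_space := prod_topology (fun _ : nat => nat).

(* The classical notion when T is Polish, as LF is. *)
Definition analytic (T : topologicalType) (A : set T) : Prop :=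
  A = set0 \/ exists2 f : baire_space -> T, continuous f & range f = A.

Definition coanalytic (T : topologicalType) (A : set T) : Prop :=
  analytic (~` A).

Definition Sigma11_Pi11_coloring (delta : LF -> bool) : Prop :=
  forall i : bool,
    analytic (delta @^-1` [set i]) \/ coanalytic (delta @^-1` [set i]).

Definition lattice_filter d (L : latticeType d) (F : set L) : Prop :=
  [/\ F !=set0,
      forall x y, F x -> (x <= y)%O -> F y &
      forall x y, F x -> F y -> F (x `&` y)%O].

Definition card_lt T U (A : set T) (B : set U) : Prop :=
  (A #<= B) /\ ~ (B #<= A).

Definition compatible d (P : porderType d) (p q : P) : Prop :=
  exists r : P, (r <= p)%O /\ (r <= q)%O.

Definition antichain d (P : porderType d) (A : set P) : Prop :=
  forall p q, A p -> A q -> p <> q -> ~ compatible p q.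

Definition ccc d (P : porderType d) : Prop :=
  forall A : set P, antichain A -> countable A.

Definition forcing_dense d (P : porderType d) (D : set P) : Prop :=
  forall p, exists2 q, D q & (q <= p)%O.

Definition forcing_filter d (P : porderType d) (G : set P) : Prop :=
  [/\ G !=set0,
      forall p q, G p -> (p <= q)%O -> G q &
      forall p q, G p -> G q -> exists2 r, G r & (r <= p)%O /\ (r <= q)%O].

(* [set: set nat] has the cardinality of the continuum, so that under CH this
   quantifies over countable families DD only. *)
Definition Martin_Axiom : Prop :=
  forall d (P : porderType d), [set: P] !=set0 -> ccc P ->
  forall DD : set (set P),
    card_lt DD [set: set nat] -> DD `<=` @forcing_dense d P ->
  exists2 G : set P, forcing_filter G & forall D, DD D -> D `&` G !=set0.

(* Main.v *)
Require Import Defs.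
From HB Require Import structures.
From mathcomp Require Import finmap.
From mathcomp Require Import all_boot all_order all_algebra.
From mathcomp Require Import all_classical all_reals all_analysis.

(** For pairwise disjoint cycles [c_p] of distinct prime lengths [p], every
    subgroup of the group generated by the [c_p] is generated by the [c_p] it
    contains, because a suitable power of an element isolates any one of its
    components. Hence below this group [LF] is the power set of the set of
    primes, finite groups corresponding to finite sets. Analytic colorings of
    infinite sets have homogeneous sets (Silver), also below any prescribed
    infinite set, and there are only continuum many of them. Martin's Axiom
    provides pseudo-intersections of almost decreasing chains of length less
    than the continuum, so all colorings can be treated along a single almost
    decreasing tower of sets of primes, and the tower generates the filter. *)

Set Implicit Arguments.
Unset Strict Implicit.
Unset Printing Implicit Defensive.

Local Open Scope classical_set_scope.
Local Open Scope card_scope.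

(** * Fusion and the Ramsey property of Souslin sets *)

Definition unbounded (A : set nat) := forall n, exists2 m, n <= m & A m.

Definition from (n : nat) (A : set nat) : set nat := [set m | A m /\ n <= m].

Lemma from_sub n A : from n A `<=` A.
Proof. by move=> m []. Qed.

Lemma from_mono n A B : A `<=` B -> from n A `<=` from n B.
Proof. by move=> AB m [/AB]. Qed.

Lemma from_unbounded n A : unbounded A -> unbounded (from n A).
Proof.
by move=> uA k; have [m] := uA (maxn n k); rewrite geq_max => /andP[? ?] ?; exists m.
Qed.

Lemma unboundedS A B : A `<=` B -> unbounded A -> unbounded B.
Proof. by move=> AB uA n; have [m ? /AB] := uA n; exists m. Qed.

Lemma unbounded_setD A B : unbounded A -> ~ unbounded B -> unbounded (A `\` B).
Proof.
move=> uA /existsNP[n nB] k; have [m] := uA (maxn n k).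
rewrite geq_max => /andP[nm km] Am; exists m => //; split => // Bm.
by apply: nB; exists m.
Qed.

Lemma unboundedNP A : ~ unbounded A -> exists N, forall m, A m -> m < N.
Proof.
move=> /existsNP[N NA]; exists N => m Am; rewrite ltnNge; apply/negP => Nm.
by apply: NA; exists m.
Qed.

(* The increasing enumeration of [C] below [n] is stored in decreasing order. *)
Fixpoint seg (C : set nat) (n : nat) : seq nat :=
  if n is n'.+1 then (if `[< C n' >] then n' :: seg C n' else seg C n') else [::].

Lemma mem_seg C n m : (m \in seg C n) = (m < n) && `[< C m >].
Proof.
elim: n => //= n IHn; rewrite ltnS [m <= n]leq_eqVlt.
case: asboolP => Cn; rewrite ?inE IHn; case: eqVneq => [->|]//=.
  by rewrite asboolT.
by rewrite ltnn asboolF.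
Qed.

Lemma eq_seg C D n : (forall m, m < n -> C m <-> D m) -> seg C n = seg D n.
Proof.
elim: n => //= n IHn CD; rewrite IHn => [|m mn]; last by apply: CD; exact: ltnW.
by rewrite (propext (CD n (leqnn _))).
Qed.

Lemma seg_from0 C n k : k <= n -> seg (from n C) k = [::].
Proof.
elim: k => //= k IHk kn; rewrite IHk ?(ltnW kn)// asboolF// => -[_].
by rewrite leqNgt kn.
Qed.

Lemma seg_cat C n k : n <= k -> seg C k = seg (from n C) k ++ seg C n.
Proof.
elim: k => [|k IHk]; first by rewrite leqn0 => /eqP ->.
rewrite leq_eqVlt => /predU1P[->|nk]; first by rewrite seg_from0.
rewrite /= IHk//; case: asboolP => [Ck|nC]; first by rewrite asboolT.
by rewrite asboolF// => -[].
Qed.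

Lemma seg_from C n k : seg (from n C) k ++ seg C n = seg C (maxn n k).
Proof.
have [kn|/ltnW nk] := leqP k n; last by rewrite (seg_cat C nk).
by rewrite seg_from0.
Qed.

Lemma seg_min C m : C m -> (forall k, C k -> m <= k) -> seg C m.+1 = [:: m].
Proof.
move=> Cm minm; have mC : C `<=` from m C by move=> k Ck; split => //; exact: minm.
by rewrite /= asboolT// (_ : C = from m C) ?seg_from0//; apply/seteqP; split => // k [].
Qed.

Definition extend (s : seq nat) (D : set nat) : set nat := [set m | m \in s \/ D m].

Lemma seg_extend C D n k : D `<=` from n setT ->
  seg (extend (seg C n) D) (maxn n k) = seg D k ++ seg C n.
Proof.
move=> Dn; set E := extend _ _.
have En m : m < n -> E m <-> C m.
  move=> mn; rewrite /E /extend /= mem_seg mn/=.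
  split => [[/asboolP//|/Dn[_]]|?]; first by rewrite leqNgt mn.
  by left; apply/asboolP.
have -> : D = from n E.
  apply/seteqP; split => [m Dm|m [[+|//] nm]].
    by have [_ nm] := Dn m Dm; split => //; right.
  by rewrite mem_seg ltnNge nm.
by rewrite -(eq_seg En) seg_from.
Qed.

Lemma extend_seg_from C n : extend (seg C n) (from n C) = C.
Proof.
apply/seteqP; split => m; rewrite /extend /= mem_seg.
  by case=> [/andP[_ /asboolP]|[]].
move=> Cm; have [nm|mn] := leqP n m; first by right.
by left; rewrite asboolT.
Qed.

(** All candidates for an initial segment below [n]; their finiteness lets one fusion stage treat
    every stem at once. *)
Fixpoint segs (n : nat) : seq (seq nat) :=
  if n is n'.+1 then segs n' ++ [seq n' :: s | s <- segs n'] else [:: [::]].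

Lemma seg_segs C n : seg C n \in segs n.
Proof.
elim: n => //= n IHn; rewrite mem_cat; case: ifP => _; last by rewrite IHn.
by rewrite map_f ?orbT.
Qed.

Definition hereditary (D : set nat -> Prop) :=
  forall A B, unbounded B -> B `<=` A -> D A -> D B.

Definition dense_below (A0 : set nat) (D : set nat -> Prop) :=
  forall A, unbounded A -> A `<=` A0 -> exists2 B, B `<=` A & unbounded B /\ D B.

Lemma dense_all (T : eqType) (D : T -> set nat -> Prop) A0 (l : seq T) :
  (forall t, hereditary (D t)) -> (forall t, t \in l -> dense_below A0 (D t)) ->
  dense_below A0 (fun A => forall t, t \in l -> D t A).
Proof.
move=> her; elim: l => [|t l IHl] dns A uA AA0; first by exists A.
have [|B BA [uB DB]] := IHl _ A uA AA0.
  by move=> u ul; apply: dns; rewrite inE ul orbT.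
have [C CB [uC DC]] := dns t (mem_head _ _) B uB (subset_trans BA AA0).
exists C; first exact: subset_trans BA.
split => // u; rewrite inE => /predU1P[->//|ul].
exact: (her u B C uC CB (DB u ul)).
Qed.

(** Diagonal intersection: in a decreasing sequence, [A n] settles the stems below [n]. The set of
    all [n] with [A n n] has its part from [n] on inside [A n], so it inherits every decision. *)
Lemma fusion (A0 : set nat) (P : seq nat -> set nat -> Prop) :
  unbounded A0 -> (forall s, hereditary (P s)) ->
  (forall C n, C `<=` A0 -> dense_below (from n A0) (P (seg C n))) ->
  exists2 B, B `<=` A0 & unbounded B /\
    forall C n, C `<=` B -> P (seg C n) (from n B).
Proof.
move=> uA0 her dns.
have /choice[R RP] : forall nA : nat * set nat, exists B,
    unbounded nA.2 -> nA.2 `<=` A0 ->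
    [/\ unbounded B, B `<=` from nA.1 nA.2 &
        forall C, C `<=` A0 -> P (seg C nA.1) B].
  case=> n A /=; have [uA|?] := pselect (unbounded A); last by exists set0.
  have [AA0|?] := pselect (A `<=` A0); last by exists set0.
  pose Q s B := (exists2 C, C `<=` A0 & s = seg C n) -> P s B.
  have herQ s : hereditary (Q s).
    by move=> D E uE ED QD sC; apply: her uE ED (QD sC).
  have dnsQ s : s \in segs n -> dense_below (from n A0) (Q s).
    move=> _ D uD DA0; rewrite /Q.
    have [[C CA0 ->]|nC] := pselect (exists2 C, C `<=` A0 & s = seg C n).
      by have [E ED [uE PE]] := dns C n CA0 D uD DA0; exists E.
    by exists D.
  have [B BA [uB QB]] :=
    dense_all herQ dnsQ (from_unbounded n uA) (@from_mono n _ _ AA0).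
  exists B => _ _; split => // C CA0; apply: QB; first exact: seg_segs.
  by exists C.
(* Shrinking only when [n'] enters the diagonal keeps the next element of [A n] alive, so the
   diagonal is unbounded; if [n'] stays out, no new stem arises. *)
pose fix A n : set nat :=
  if n is n'.+1 then (if `[< A n' n' >] then R (n, A n') else A n')
  else R (0, A0).
have AP n : unbounded (A n) /\ A n `<=` A0.
  elim: n => [|n [uA AA0]] /=.
    by have [|? sub _] := RP (0, A0) uA0 => //; split => // m /sub[].
  case: asboolP => // _; have [? sub _] := RP (n.+1, A n) uA AA0.
  by split => // m /sub[/AA0].
have AS n : A n.+1 `<=` A n.
  move=> m /=; case: asboolP => // _.
  by have [uA AA0] := AP n; have [_ sub _] := RP (n.+1, A n) uA AA0 => /sub[].
have Amono n m : n <= m -> A m `<=` A n.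
  elim: m => [|m IHm]; first by rewrite leqn0 => /eqP ->.
  by rewrite leq_eqVlt => /predU1P[->//|nm] k /AS; exact: IHm.
have uB : unbounded [set n | A n n].
  move=> n; have [m0 nm0 Am0] := (AP n).1 n.
  have ex : exists m, (n <= m) && `[< A n m >].
    by exists m0; rewrite nm0; exact/asboolP.
  case: (ex_minnP ex) => m /andP[nm /asboolP Am] minm; exists m => //=.
  suff : forall k, n <= k <= m -> A k = A n by move=> ->//; rewrite nm leqnn.
  elim=> [|k IHk]; first by rewrite leqn0 => /andP[/eqP ->].
  move=> /andP[nk km]; move: nk; rewrite leq_eqVlt => /predU1P[->//|nk].
  have kE : A k = A n by apply: IHk; rewrite -ltnS nk ltnW.
  rewrite /= asboolF// kE => Ak; have := minm k.
  by rewrite -ltnS nk asboolT// => /(_ isT); rewrite leqNgt km.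
exists [set n | A n n]; first by move=> n /(AP n).2.
split => // C n CB.
apply: (her _ (A n)); first exact: from_unbounded.
  by move=> m [Am nm]; exact: Amono nm _ Am.
have CA0 : C `<=` A0 by move=> m /CB /(AP m).2.
elim: n => [|n IHn] /=; first by have [|_ _ /(_ C CA0)] := RP (0, A0) uA0.
have [An|nAn] := asboolP (A n n); last by rewrite asboolF// => /CB.
have [uA AA0] := AP n; have [_ _ PC] := RP (n.+1, A n) uA AA0; exact: PC.
Qed.

(** * The Nash-Williams dichotomy *)

Section NashWilliams.
Variable Q : seq nat -> Prop.

(** Combinatorial forcing in the style of Galvin and Prikry; [u] is the stem already read, and later
    elements are prepended. *)
Definition accepts (A : set nat) (u : seq nat) :=
  forall D, D `<=` A -> unbounded D -> exists n, Q (seg D n ++ u).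

Definition rejects (A : set nat) (u : seq nat) :=
  forall B, B `<=` A -> unbounded B -> ~ accepts B u.

Lemma acceptsS A B u : B `<=` A -> accepts A u -> accepts B u.
Proof. by move=> BA aA D DB; apply: aA; exact: subset_trans BA. Qed.

Lemma rejectsS A B u : B `<=` A -> rejects A u -> rejects B u.
Proof. by move=> BA rA D DB; apply: rA; exact: subset_trans BA. Qed.

(** Acceptance passes to tails, so an accepting subset of [B] would have an accepting tail inside
    [from n A]. *)
Lemma rejects_from n A B u : B `<=` A -> rejects (from n A) u -> rejects B u.
Proof.
move=> BA rA D DB uD aD; apply: (rA (from n D)).
- by apply: from_mono; exact: subset_trans BA.
- exact: from_unbounded.
- by apply: acceptsS aD; exact: from_sub.
Qed.

Lemma accepts_or_rejects A u :
  unbounded A -> exists2 B, B `<=` A & unbounded B /\ (accepts B u \/ rejects B u).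
Proof.
move=> uA.
have [[B BA [uB aB]]|nB] := pselect (exists2 B, B `<=` A & unbounded B /\ accepts B u).
  by exists B => //; split => //; left.
by exists A => //; split => //; right => B BA uB aB; apply: nB; exists B.
Qed.

(** After a fusion deciding all longer stems, only boundedly many [m] lead to acceptance of
    [m :: u]: an unbounded set of them would accept [u], by reading the least element of a subset
    first. Those [m] are discarded. *)
Lemma rejects_cons u A : unbounded A -> rejects A u ->
  exists2 B, B `<=` A & unbounded B /\ forall m, B m -> rejects B (m :: u).
Proof.
move=> uA rA.
pose P s B := accepts B (s ++ u) \/ rejects B (s ++ u).
have herP s : hereditary (P s).
  move=> C D _ DC [aC|rC]; [left; exact: acceptsS aC|right; exact: rejectsS rC].
have dnsP C n : C `<=` A -> dense_below (from n A) (P (seg C n)).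
  by move=> _ D uD _; exact: accepts_or_rejects.
have [B BA [uB PB]] := fusion uA herP dnsP.
pose E := [set m | B m /\ accepts (from m.+1 B) (m :: u)].
have nE : ~ unbounded E.
  move=> uE; apply: (rA E) => // [m [/BA]//|D DE uD].
  have [m1 _ Dm1] := uD 0.
  have ex : exists m, `[< D m >] by exists m1; exact/asboolP.
  case: (ex_minnP ex) => m /asboolP Dm minm.
  have [_ aD] := DE m Dm.
  have [||n Qn] := aD (from m.+1 D).
  - by apply: from_mono => k /DE[].
  - exact: from_unbounded.
  exists (maxn m.+1 n); rewrite -seg_from -catA seg_min// => k Dk.
  by apply: minm; exact/asboolP.
exists (B `\` E); first by move=> m [/BA].
split => [|m [Bm nEm]]; first exact: unbounded_setD.
have segm : seg [set m] m.+1 = [:: m] by apply: seg_min => // k ->.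
have mB : [set m] `<=` B by move=> k ->.
have := PB [set m] m.+1 mB; rewrite segm => -[aB|]; first by case: nEm.
by apply: rejects_from => k [].
Qed.

(** If the empty stem is rejected, a fusion with [rejects_cons] makes rejection persist along every
    subset of [B]; a stem in [Q] is accepted at once, so none occurs. *)
Lemma nash_williams A : unbounded A ->
  exists2 B, B `<=` A & unbounded B /\
    ((forall C, C `<=` B -> unbounded C -> exists n, Q (seg C n)) \/
     (forall C, C `<=` B -> forall n, ~ Q (seg C n))).
Proof.
move=> uA; have [A1 A1A [uA1 [aA1|rA1]]] := accepts_or_rejects [::] uA.
  exists A1 => //; split => //; left => C CA1 uC.
  by have [n] := aA1 C CA1 uC; rewrite cats0; exists n.
pose P s B := accepts B s \/ forall m, B m -> rejects B (m :: s).
have herP s : hereditary (P s).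
  move=> C D _ DC [aC|rC]; [left; exact: acceptsS aC|right => m /DC /rC].
  exact: rejectsS.
have dnsP C n : C `<=` A1 -> dense_below (from n A1) (P (seg C n)).
  move=> _ D uD _; have [E ED [uE [aE|rE]]] := accepts_or_rejects (seg C n) uD.
    by exists E => //; split => //; left.
  have [F FE [uF rF]] := rejects_cons uE rE.
  by exists F; [exact: subset_trans ED|split => //; right].
have [B BA1 [uB PB]] := fusion uA1 herP dnsP.
exists B; first exact: subset_trans A1A.
split => //; right => C CB n Qn.
have : rejects B (seg C n).
  elim: n {Qn} => [|n IHn] /=; first exact: rejectsS rA1.
  have [Cn|//] := asboolP (C n).
  have [aB|rB] := PB C n CB.
    case: (IHn (from n B)) => //; [exact: from_sub|exact: from_unbounded].
  apply: (@rejects_from n B) => //.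
  by apply: rB; split => //; exact: CB.
by move=> /(_ B); apply => // D DB uD; exists 0.
Qed.
End NashWilliams.

(** * Souslin schemes on sets of natural numbers *)

Section Souslin.
Variable X : seq nat -> set nat -> Prop.

(** A largeness notion: shrinking [A] cannot avoid [X t] beyond the stem [s]. Branches are built
    through positive pairs. *)
Definition positive (A : set nat) (s t : seq nat) :=
  forall B, B `<=` A -> unbounded B ->
  exists D, [/\ D `<=` B, unbounded D & X t (extend s D)].

Lemma positiveS A B s t : B `<=` A -> positive A s t -> positive B s t.
Proof. by move=> BA pA C CB; apply: pA; exact: subset_trans BA. Qed.

Lemma positive_from n A s t : positive (from n A) s t -> positive A s t.
Proof.
move=> pA B BA uB; have [|//|D [DB uD XD]] := pA (from n B).
- exact: from_mono.
- exact: from_unbounded.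
by exists D; split => //; apply: subset_trans (@from_sub n B).
Qed.

(* Finitely many, but every [t] is eventually tested along an unbounded set. *)
Definition tests (s : seq nat) : seq (seq nat) :=
  [::] :: pmap unpickle (iota 0 (sumn s).+1).

Lemma tests_seg t C : unbounded C -> exists N, forall n, N <= n -> t \in tests (seg C n).
Proof.
move=> /(_ (pickle t))[c tc Cc]; exists c.+1 => n cn.
rewrite inE mem_pmap; apply/orP; right; apply/mapP.
exists (pickle t); rewrite ?pickleK// mem_iota add0n ltnS /=; apply: leq_trans tc _.
have : c \in seg C n by rewrite mem_seg cn; exact/asboolP.
elim: (seg C n) => //= x s IHs; rewrite inE => /predU1P[->|/IHs cs].
  exact: leq_addr.
exact: leq_trans cs (leq_addl _ _).
Qed.

Hypothesis XS : forall t C, X t C -> exists m, X (rcons t m) C.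

(** A fusion decides, for each stem and each tested [t], between positivity and avoidance of [X t].
    A member [C] of [X t] rules out avoidance at its own stems, which eventually test [t]. *)
Lemma positive_decided A : unbounded A ->
  exists2 B, B `<=` A & unbounded B /\
    forall t C, C `<=` B -> unbounded C -> X t C ->
    exists N, forall n, N <= n -> positive B (seg C n) t.
Proof.
move=> uA.
pose P1 s t B := positive B s t \/ forall D, D `<=` B -> unbounded D -> ~ X t (extend s D).
have herP1 s t : hereditary (P1 s t).
  move=> C D _ DC [pC|nC]; [left; exact: positiveS pC|right => E ED].
  by apply: nC; exact: subset_trans DC.
pose P s B := forall t, t \in tests s -> P1 s t B.
have herP s : hereditary (P s).
  by move=> C D uD DC PC t /PC; exact: herP1.
have dnsP C n : C `<=` A -> dense_below (from n A) (P (seg C n)).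
  move=> _; apply: dense_all => [t|t _ D uD _]; first exact: herP1.
  have [pD|/existsNP[E /not_implyP[ED /not_implyP[uE nE]]]] :=
    pselect (positive D (seg C n) t); first by exists D => //; split => //; left.
  exists E => //; split => //; right => F FE uF XF; apply: nE.
  by exists F.
have [B BA [uB PB]] := fusion uA herP dnsP.
exists B => //; split => // t C CB uC XC.
have [N tN] := tests_seg t uC; exists N => n /tN tn.
have [/positive_from//|] := PB C n CB t tn.
move=> /(_ (from n C)) []; first exact: from_mono.
  exact: from_unbounded.
by rewrite extend_seg_from.
Qed.

(** In the second alternative the nodes of the branch [y] are met only by approximations [C'] of
    [C]; continuity closes this gap in the application. *)
Lemma souslin_ramsey A : unbounded A ->
  exists2 B, B `<=` A & unbounded B /\
    ((forall C, C `<=` B -> unbounded C -> ~ X [::] C) \/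
     (forall C, C `<=` B -> unbounded C -> exists y : nat -> nat, forall i,
        exists2 C', X (mkseq y i) C' & forall k, k < i -> C' k <-> C k)).
Proof.
move=> uA; have [A2 A2A [uA2 posA2]] := positive_decided uA.
have [p0|np0] := pselect (positive A2 [::] [::]); last first.
  move: np0 => /existsNP[B /not_implyP[BA2 /not_implyP[uB nB]]].
  exists B; first exact: subset_trans A2A.
  split => //; left => C CB uC XC; apply: nB; exists C; split => //.
  by rewrite (_ : extend [::] C = C)//; apply/seteqP; split => [m []//|m Cm]; right.
(* A member of [X t] lies in some [X (rcons t m)], hence by [posA2] has long
   stems positive for [rcons t m]. So the second alternative of Nash-Williams
   fails for [Q s t] when [s] is positive for [t], and along every unbounded set
   positive stems can be prolonged while [t] grows. *)
pose Q s t u := u <> [::] /\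
  exists2 m, rcons t m \in tests (u ++ s) & positive A2 (u ++ s) (rcons t m).
pose P1 s t B := ~ positive A2 s t \/
  forall D, D `<=` B -> unbounded D -> exists n, Q s t (seg D n).
have herP1 s t : hereditary (P1 s t).
  move=> C D _ DC [pC|nC]; [by left|right => E ED].
  by apply: nC; exact: subset_trans DC.
pose P s B := forall t, t \in tests s -> P1 s t B.
have herP s : hereditary (P s).
  by move=> C D uD DC PC t /PC; exact: herP1.
have dnsP C n : C `<=` A2 -> dense_below (from n A2) (P (seg C n)).
  move=> CA2; apply: dense_all => [t|t _ D uD DA2]; first exact: herP1.
  have [pD|?] := pselect (positive A2 (seg C n) t); last by exists D => //; split => //; left.
  have [E ED [uE [yE|nE]]] := nash_williams (Q (seg C n) t) uD.
    by exists E => //; split => //; right.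
  have EA2 : E `<=` from n A2 by exact: subset_trans DA2.
  have [F [FE uF /XS[m XF]]] := pD E (subset_trans EA2 (@from_sub _ _)) uE.
  have eA2 : extend (seg C n) F `<=` A2.
    by move=> k [|/FE/EA2[]//]; rewrite mem_seg => /andP[_ /asboolP/CA2].
  have ueF : unbounded (extend (seg C n) F).
    by apply: unboundedS uF => k; right.
  have [N posN] := posA2 _ _ eA2 ueF XF.
  have [M tM] := tests_seg (rcons t m) ueF.
  (* The segment up to [x.+1] contains [x], so it is nonempty, and it is long enough for both
     positivity and testing. *)
  have [x Nx Fx] := uF (maxn N (maxn M n)).
  case: (nE F FE x.+1); split; first by rewrite /= asboolT.
  have sE : seg (extend (seg C n) F) x.+1 = seg F x.+1 ++ seg C n.
    rewrite -seg_extend => [|k /FE/EA2[_]//].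
    congr seg; apply/esym/maxn_idPr; move: Nx; rewrite !geq_max => /and3P[_ _].
    exact: leqW.
  move: Nx; rewrite !geq_max => /and3P[/leqW/posN + /leqW/tM + _].
  by rewrite sE => ? ?; exists m.
have [B BA2 [uB PB]] := fusion uA2 herP dnsP.
exists B; first exact: subset_trans A2A.
split => //; right => C CB uC.
(* States of the branch construction: how far [C] has been read, and the node reached. *)
pose good (nt : nat * seq nat) :=
  nt.2 \in tests (seg C nt.1) /\ positive A2 (seg C nt.1) nt.2.
have /choice[nxt nxtP] : forall nt, exists nm : nat * nat, good nt ->
    nt.1 < nm.1 /\ good (nm.1, rcons nt.2 nm.2).
  case=> n t; have [[tn pn]|?] := pselect (good (n, t)); last by exists (0, 0).
  have [//|yD] := PB C n CB t tn.
  have [||k [sk [m tm pm]]] := yD (from n C).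
  - exact: from_mono.
  - exact: from_unbounded.
  exists (maxn n k, m) => _; split; last by rewrite /good /= -seg_from.
  rewrite /= leq_max ltnn/= ltnNge; apply/negP => kn; apply: sk.
  exact: seg_from0.
pose fix st i : nat * seq nat :=
  if i is i'.+1 then ((nxt (st i')).1, rcons (st i').2 (nxt (st i')).2) else (0, [::]).
have goodst i : good (st i) by elim: i => [|i /nxtP[]].
have lest i : i <= (st i).1.
  by elim: i => //= i IHi; have [+ _] := nxtP _ (goodst i); exact: leq_ltn_trans.
exists (fun i => (nxt (st i)).2) => i.
have -> : mkseq (fun i => (nxt (st i)).2) i = (st i).2.
  by elim: i => // i IHi; rewrite mkseqS IHi.
have [_ pi] := goodst i.
(* [D] starts at or after [(st i).1], which is at least [i], so prefixing the segment of [C] gives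
   agreement with [C] below [i]. *)
have [D [DA2 uD XD]] := pi _ (@from_sub (st i).1 A2) (from_unbounded _ uA2).
exists (extend (seg C (st i).1) D) => // k ki.
have kst : k < (st i).1 by exact: leq_trans (lest i).
rewrite /extend /= mem_seg kst /=; split => [[/asboolP//|/DA2[_]]|?].
  by rewrite leqNgt kst.
by left; exact/asboolP.
Qed.
End Souslin.

(** * Towers under Martin's Axiom *)

Lemma inj_card_leT (S T : Type) (f : S -> T) (U : set T) :
  injective f -> (forall x, U (f x)) -> [set: S] #<= U.
Proof.
move=> finj fU; have finj' : {in [set: S] &, injective f} by move=> x y _ _ /finj.
apply: card_le_trans (subset_card_le (_ : f @` [set: S] `<=` U)).
  by have := inj_card_eq finj'; rewrite card_eq_le => /andP[].
by move=> _ [x _ <-].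
Qed.

Lemma continuum_uncountable : ~ countable [set: set nat].
Proof.
move=> /countable_injP[f finj].
pose D := [set n | exists2 A, f A = n & ~ A n].
have nD : ~ D (f D).
  move=> HD; case: (HD) => A /finj fA; apply.
  by rewrite (_ : A = D)//; apply: fA; rewrite inE.
by apply: (nD); exists D.
Qed.

Definition set_pair (A B : set nat) : set nat :=
  [set n | if odd n then B n./2 else A n./2].

Lemma set_pair_inj A B A' B' : set_pair A B = set_pair A' B' -> A = A' /\ B = B'.
Proof.
move=> e; split; apply/funext => n.
  have := congr1 (@^~ n.*2) e.
  by rewrite /set_pair /mkset odd_double doubleK.
have := congr1 (@^~ n.*2.+1) e.
by rewrite /set_pair /mkset /= odd_double /= uphalf_double.
Qed.

(* Of the rows [{A} * 2^N] of an injection of [2^N * 2^N] into [U `|` V], either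
   one lands in [U], or picking a point outside [U] in each row gives an
   injection into [V]. *)
Lemma continuum_setU (T : pointedType) (U V : set T) :
  [set: set nat] #<= U `|` V -> [set: set nat] #<= U \/ [set: set nat] #<= V.
Proof.
move=> /pcard_leP/unsquash f; pose h A B := f (set_pair A B).
have hUV A B : (U `|` V) (h A B) by exact: funS.
have hinj A B A' B' : h A B = h A' B' -> A = A' /\ B = B'.
  by move=> e; apply/set_pair_inj/(inj (f := f)); rewrite ?inE.
have [[A hA]|nU] := pselect (exists A, forall B, U (h A B)).
  by left; apply: (@inj_card_leT _ _ (h A)) => // B B' /hinj[].
right; have /choice[g gV] : forall A, exists B, V (h A B).
  move=> A; apply: contrapT => nV; apply: nU; exists A => B.
  by have [//|VB] := hUV A B; case: nV; exists B.
by apply: (@inj_card_leT _ _ (fun A => h A (g A))) => // A A' /hinj[].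
Qed.

(** Mathias-Prikry forcing relative to [FF]: the stem is a finite part of the generic set, and later
    elements must come from [side]. *)
Record stem_cond (FF : set (set nat)) :=
  StemCond { stem : {fset nat}; side : set nat; _ : FF side }.

Section StemCond.
Variable FF : set (set nat).
Local Notation cond := (stem_cond FF).

HB.instance Definition _ := gen_eqMixin cond.
HB.instance Definition _ := gen_choiceMixin cond.

Lemma side_mem (p : cond) : FF (side p). Proof. by case: p. Qed.

Lemma cond_ext (p q : cond) : stem p = stem q -> side p = side q -> p = q.
Proof.
case: p q => [s A FA] [t B FB] /= st AB; case: _ / st; case: _ / AB FB => FB.
by congr StemCond; exact: Prop_irrelevance.
Qed.

Definition cond_le (p q : cond) : bool :=
  `[< [/\ {subset stem q <= stem p}, side p `<=` side q &
          forall m, m \in stem p -> m \in stem q \/ side q m] >].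

Fact cond_display : Order.disp_t. Proof. exact: Order.Disp tt tt. Qed.

Lemma cond_le_refl : reflexive cond_le.
Proof. by move=> p; apply/asboolP; split => // m; left. Qed.

Lemma cond_le_anti : antisymmetric cond_le.
Proof.
move=> p q /andP[/asboolP[sqp pq _] /asboolP[spq qp _]].
apply: cond_ext; last exact/seteqP.
by apply/fsetP => m; apply/idP/idP; [exact: spq|exact: sqp].
Qed.

Lemma cond_le_trans : transitive cond_le.
Proof.
move=> q p r /asboolP[sqp pq mpq] /asboolP[srq qr mqr]; apply/asboolP.
split; [by move=> m /srq/sqp|exact: subset_trans qr|].
by move=> m /mpq[/mqr//|/qr]; right.
Qed.

HB.instance Definition _ :=
  Order.Le_isPOrder.Build cond_display cond cond_le_refl cond_le_anti cond_le_trans.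

Lemma cond_leP (p q : cond) :
  reflect [/\ {subset stem q <= stem p}, side p `<=` side q &
              forall m, m \in stem p -> m \in stem q \/ side q m] (p <= q)%O.
Proof. exact: asboolP. Qed.

Hypothesis FFI : forall A B, FF A -> FF B -> FF (A `&` B).

(** Conditions with equal stems are compatible by intersecting their sides, so an antichain injects
    into the countable set of stems. *)
Lemma stem_cond_ccc : ccc cond.
Proof.
move=> A antiA; apply/countable_injP; exists (fun p => pickle (stem p : seq nat)).
move=> p q /set_mem Ap /set_mem Aq /(pcan_inj pickleK)/val_inj spq.
apply: contrapT => npq; apply: (antiA p q Ap Aq npq).
exists (StemCond (stem p) (FFI (side_mem p) (side_mem q))).
split; apply/cond_leP => /=; split.
- by [].
- by move=> m [].
- by left.
- by rewrite spq.
- by move=> m [].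
- by rewrite spq; left.
Qed.

End StemCond.

Definition almost_sub (A B : set nat) := exists n, from n A `<=` B.

(** The part in [A0] of the union of the generic stems works: the dense sets [E n] make it
    unbounded, and once the side lies inside [A], only members of [A] are added. *)
Lemma pseudo_intersection (FF I : set (set nat)) (A0 : set nat) :
  Martin_Axiom -> FF A0 -> (forall A B, FF A -> FF B -> FF (A `&` B)) ->
  (forall A, FF A -> unbounded A) -> I `<=` FF -> ~ ([set: set nat] #<= I) ->
  exists2 P, P `<=` A0 & unbounded P /\ forall A, I A -> almost_sub P A.
Proof.
move=> MA FA0 FFI FFu IFF cI; pose cond := stem_cond FF.
pose D (A : set nat) : set cond := [set p | side p `<=` A].
pose E (n : nat) : set cond := [set p | exists m, [/\ m \in stem p, n <= m & A0 m]].
pose DD := (D @` I) `|` range E.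
have dense : DD `<=` @forcing_dense _ cond.
  move=> _ [[A /IFF FA <-]|[n _ <-]] p.
    exists (StemCond (stem p) (FFI _ _ (side_mem p) FA)); first by move=> m [].
    by apply/cond_leP; split; [by []|by move=> m []|by move=> m; left].
  have [m nm [pm A0m]] := FFu _ (FFI _ _ (side_mem p) FA0) n.
  exists (StemCond (m |` stem p)%fset (side_mem p)).
    by exists m; rewrite /= fset1U1.
  apply/cond_leP; split => //= [k kp|k]; first by rewrite in_fsetU kp orbT.
  by rewrite in_fset1U => /predU1P[->|]; [right|left].
have cDD : card_lt DD [set: set nat].
  split.
    (* Bit 0 of a code distinguishes the two kinds of dense sets; the remaining bits name a member
       of [I] or, as a singleton, a number. *)
    pose h (A : set nat) :=
      if `[< A 0 >] then D [set n | A n.+1] else E (xget 0 [set n | A n.+1]).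
    apply: card_le_trans (card_image_le h _); apply: subset_card_le.
    move=> _ [[A IA <-]|[n _ <-]].
      exists [set k | if k is k'.+1 then A k' else True] => //.
      by rewrite /h asboolT.
    exists [set k | k = n.+1] => //; rewrite /h asboolF//; congr E.
    by case: xgetP => [m _ /= []//|/(_ n)[]].
  move=> /continuum_setU[cD|cE].
    by apply: cI; exact: card_le_trans cD (card_image_le _ _).
  by apply: continuum_uncountable; exact: card_le_trans cE (card_image_le _ _).
have p0 : [set: cond] !=set0 by exists (StemCond fset0 FA0).
have [G [_ _ Gdir] GDD] := MA _ cond p0 (stem_cond_ccc FFI) DD cDD dense.
exists [set m | A0 m /\ exists2 p, G p & m \in stem p]; first by move=> m [].
split => [n|A IA].
  have [|p [[m [mp nm A0m]] Gp]] := GDD (E n); first by right; exists n.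
  by exists m => //; split => //; exists p.
have [|p [Dp Gp]] := GDD (D A); first by left; exists A.
(* Elements of the generic set beyond the maximum of [stem p] must come from [side p]. *)
exists (\max_(m <- stem p) m).+1 => m [[_ [q Gq mq]] mp].
have [r Gr [/cond_leP[_ _ rp] /cond_leP[qr _ _]]] := Gdir p q Gp Gq.
have [ms|/Dp//] := rp m (qr m mq).
by move: mp; rewrite ltnNge (leq_bigmax_seq (P := xpredT) (F := id)).
Qed.

(** If a well-order has initial segments of full size, take the least point [x0] bounding one and
    pull the order back along an injection into the points below [x0]. *)
Lemma continuum_order : exists lt : set nat -> set nat -> Prop,
  [/\ well_founded lt, forall x y, [\/ lt x y, x = y | lt y x] &
      forall x, ~ ([set: set nat] #<= [set y | lt y x])].
Proof.
have [R woR] := wochoice.well_ordering_principle (set nat).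
have Rmin (P : set (set nat)) : P !=set0 -> exists2 z, P z & forall x, P x -> R z x.
  move=> [x0 Px0].
  have [|z [[Pz zmin] _]] := woR [pred x | `[< P x >]]; first by exists x0; exact/asboolP.
  by exists z => [|x Px]; [exact/asboolP|apply: zmin; exact/asboolP].
have Rtot x y : R x y \/ R y x.
  have [|z [->|->] zmin] := Rmin [set x; y]; first by exists x; left.
    by left; apply: zmin; right.
  by right; apply: zmin; left.
have Ranti x y : R x y -> R y x -> x = y.
  move=> Rxy Ryx; have [|z [_ zuniq]] := woR [pred z | (z == x) || (z == y)].
    by exists x; rewrite inE eqxx.
  have Rr u : R u u by case: (Rtot u u).
  rewrite -(zuniq x) ?(zuniq y)//; split; rewrite ?inE ?eqxx ?orbT// => u;
    by rewrite inE => /orP[]/eqP ->.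
pose lt0 y x := R y x /\ y <> x.
have wf0 : well_founded lt0.
  move=> x; apply: contrapT => nx.
  have [|z nz zmin] := Rmin [set x | ~ Acc lt0 x]; first by exists x.
  apply: nz; constructor => y [Ryz yz]; apply: contrapT => /zmin Rzy.
  exact: yz (Ranti _ _ Ryz Rzy).
have tot0 x y : [\/ lt0 x y, x = y | lt0 y x].
  have [->|xy] := pselect (x = y); first by constructor 2.
  have [Rxy|Ryx] := Rtot x y; first by constructor 1.
  by constructor 3; split => // /esym.
have [/Rmin[x0 bad0 min0]|nbad] :=
  pselect ([set x | [set: set nat] #<= [set y | lt0 y x]] !=set0); last first.
  by exists lt0; split => // x bx; apply: nbad; exists x.
move: bad0 => /pcard_leP/unsquash e.
have einj : injective e by move=> x y /inj; apply; rewrite inE.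
have elt x : lt0 (e x) x0 by exact: (@funS _ _ _ _ e x I).
exists (fun y x => lt0 (e y) (e x)); split.
- move=> x; have := wf0 (e x); move E : (e x) => u Au; elim: Au x E => v _ IHv x ev.
  by constructor => y ltyx; apply: IHv erefl; rewrite -ev.
- move=> x y; have [?|/einj ?|?] := tot0 (e x) (e y);
    by [constructor 1|constructor 2|constructor 3].
- move=> x /pcard_leP/unsquash g.
  have ginj : injective g by move=> u v /inj; apply; rewrite inE.
  have bx : [set: set nat] #<= [set y | lt0 y (e x)].
    apply: (@inj_card_leT _ _ (e \o g)); first exact: inj_comp.
    by move=> u; exact: (@funS _ _ _ _ g u I).
  by have [Rx nx] := elt x; apply: nx; apply: Ranti => //; exact: min0.
Qed.

Lemma almost_subS A B : A `<=` B -> almost_sub A B.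
Proof. by move=> AB; exists 0 => m [/AB]. Qed.

Lemma almost_sub_trans A B C : almost_sub A B -> almost_sub B C -> almost_sub A C.
Proof.
move=> [n nAB] [k kBC]; exists (maxn n k) => m [Am]; rewrite geq_max => /andP[nm km].
by apply: kBC; split => //; exact: nAB.
Qed.

Lemma almost_subI A B C : almost_sub A B -> almost_sub A C -> almost_sub A (B `&` C).
Proof.
move=> [n nAB] [k kBC]; exists (maxn n k) => m [Am]; rewrite geq_max => /andP[nm km].
by split; [exact: nAB|exact: kBC].
Qed.

Lemma almost_sub_unbounded A B : almost_sub A B -> unbounded A -> unbounded B.
Proof. by move=> [n nAB] /(from_unbounded n); exact: unboundedS. Qed.

(** Transfinite recursion: at stage [x] there are fewer than continuum many earlier members, so
    [pseudo_intersection] gives a set almost inside all of them, which is then shrunk to meet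
    [D x]. *)
Lemma generic_tower (D : set nat -> set nat -> Prop) (A0 : set nat) :
  Martin_Axiom -> unbounded A0 -> (forall x, dense_below A0 (D x)) ->
  exists T : set nat -> set nat,
    (forall x, [/\ unbounded (T x), T x `<=` A0 & D x (T x)]) /\
    forall x y, almost_sub (T x) (T y) \/ almost_sub (T y) (T x).
Proof.
move=> MA uA0 dns; have [lt [ltwf lttot ltcard]] := continuum_order.
(* The value [set0] is a default; the induction below shows that a suitable [B] always exists. *)
pose next x (g : forall y, lt y x -> set nat) : set nat := xget set0
  [set B | [/\ unbounded B, B `<=` A0, D x B & forall y h, almost_sub B (g y h)]].
pose T := Fix ltwf (fun _ => set nat) next.
have TE x : T x = next x (fun y _ => T y).
  apply: Fix_eq => z f g fg; suff -> : f = g by [].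
  by apply/functional_extensionality_dep => y; apply/functional_extensionality_dep.
suff TP x : [/\ unbounded (T x), T x `<=` A0, D x (T x) &
               forall y, lt y x -> almost_sub (T x) (T y)].
  exists T; split => [x|x y]; first by have [] := TP x.
  have [ltxy|->|ltyx] := lttot x y.
  - by right; have [_ _ _] := TP y; apply.
  - by left; exact: almost_subS.
  - by left; have [_ _ _] := TP x; apply.
elim/(well_founded_ind ltwf): x => x IHx.
suff [B Bx] : exists B, [/\ unbounded B, B `<=` A0, D x B &
                            forall y, lt y x -> almost_sub B (T y)].
  by rewrite TE; apply: (@xgetPex _ set0 [set B | [/\ unbounded B, B `<=` A0, D x B &
    forall y, lt y x -> almost_sub B (T y)]]); exists B.
(* Adding [A0] puts it into the generated filter even when [x] has no predecessor. *)
pose chain := A0 |` (T @` [set y | lt y x]).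
pose FF : set (set nat) := [set B | exists2 A, chain A & almost_sub A B].
have chain_unbounded A : chain A -> unbounded A.
  by move=> [->//|[y /IHx[] uy _ _ _ <-]].
have chain_total A B : chain A -> chain B -> almost_sub A B \/ almost_sub B A.
  move=> [->|[y yx <-]] [->|[z zx <-]].
  - by left; exact: almost_subS.
  - by right; have [_ ? _ _] := IHx z zx; exact: almost_subS.
  - by left; have [_ ? _ _] := IHx y yx; exact: almost_subS.
  - have [yz|->|zy] := lttot y z; [right|left; exact: almost_subS|left].
      by have [_ _ _] := IHx z zx; apply.
    by have [_ _ _] := IHx y yx; apply.
have FFI A B : FF A -> FF B -> FF (A `&` B).
  move=> [A' cA AA'] [B' cB BB'].
  have [AB|BA] := chain_total _ _ cA cB.
    by exists A' => //; apply: almost_subI => //; exact: almost_sub_trans BB'.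
  by exists B' => //; apply: almost_subI => //; exact: almost_sub_trans AA'.
have [||||P PA0 [uP Psub]] := @pseudo_intersection FF (T @` [set y | lt y x]) A0 MA _ FFI.
- by exists A0; [left|exact: almost_subS].
- by move=> A [A' /chain_unbounded uA' /almost_sub_unbounded]; apply.
- by move=> A IA; exists A; [right|exact: almost_subS].
- by move=> cI; apply: (ltcard x); exact: card_le_trans cI (card_image_le _ _).
have [B BP [uB DB]] := dns x P uP PA0.
exists B; split => //; first exact: subset_trans PA0.
move=> y yx; apply: almost_sub_trans (almost_subS BP) _.
by apply: Psub; exists y.
Qed.

(** * Groups of block rotations *)

(* Block [n] is the set of all [pickle (n, j)] with [j < n], so block 0 is empty. *)
Definition act (k : nat -> nat) (x : nat) : nat :=
  if (pickle_inv x : option (nat * nat)) is Some (n, j) then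
    if j < n then pickle (n, (j + k n) %% n) else x
  else x.

Lemma actE k n j : j < n -> act k (pickle (n, j)) = pickle (n, (j + k n) %% n).
Proof. by move=> jn; rewrite /act pickleK_inv jn. Qed.

Lemma block_or_fixed x :
  (exists n j, j < n /\ x = pickle (n, j)) \/ forall k, act k x = x.
Proof.
rewrite /act; have := pickle_invK (T := (nat * nat)%type) x.
case: pickle_inv => [[n j]/= <-|]; last by right.
by have [jn|nj] := ltnP j n; [left; exists n, j|right].
Qed.

Lemma act_comp k l x : act k (act l x) = act (fun n => k n + l n) x.
Proof.
have [[n [j [jn ->]]]|fx] := block_or_fixed x; last by rewrite !fx.
have n0 : 0 < n by exact: leq_ltn_trans jn.
by rewrite !actE ?ltn_mod// modnDml -addnA [l n + _]addnC.
Qed.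

Lemma eq_act k l : (forall n, 0 < n -> k n = l n %[mod n]) -> act k =1 act l.
Proof.
move=> kl x; have [[n [j [jn ->]]]|fx] := block_or_fixed x; last by rewrite !fx.
have n0 : 0 < n by exact: leq_ltn_trans jn.
by rewrite !actE// -modnDmr kl// modnDmr.
Qed.

Lemma act_id k : (forall n, 0 < n -> n %| k n) -> act k =1 id.
Proof.
move=> nk x; have [[n [j [jn ->]]]|->//] := block_or_fixed x.
have n0 : 0 < n by exact: leq_ltn_trans jn.
by rewrite actE// -modnDmr (eqP (nk n n0)) addn0 modn_small.
Qed.

Definition bounded_by (N : nat) (k : nat -> nat) := forall n, N <= n -> k n = 0.

Definition blocks (N : nat) : set nat :=
  [set pickle p | p in `I_N `*` `I_N].

Lemma finite_blocks N : finite_set (blocks N).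
Proof. exact/finite_image/finite_setX. Qed.

Lemma blocks_mem N n j : n < N -> j < n -> blocks N (pickle (n, j)).
Proof. by move=> nN jn; exists (n, j) => //; split => //=; exact: ltn_trans nN. Qed.

Lemma act_finitary N k : bounded_by N k -> finitary (act k).
Proof.
move=> kN; split.
  (* Modulo [n], the factor [n.-1] is minus one, which gives the inverse rotation. *)
  exists (act (fun n => n.-1 * k n)) => x; rewrite act_comp act_id// => -[//|n _] /=.
    by rewrite -mulSnr dvdn_mulr.
  by rewrite -mulSn dvdn_mulr.
apply: sub_finite_set (finite_blocks N) => x; rewrite /fun_supp /=.
have [[n [j [jn ->]]]|->//] := block_or_fixed x.
rewrite actE// => nf; apply: blocks_mem => //; rewrite ltnNge; apply/negP => /kN k0.
by apply: nf; rewrite k0 addn0 modn_small.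
Qed.

Definition rot N k (kN : bounded_by N k) : SF := MkSF (asboolT (act_finitary kN)).

(** One test point suffices: a rotation fixing a point of a block is trivial on that block. *)
Definition moves (g : SF) (n : nat) :=
  g (pickle (n, 0)) <> pickle (n, 0).

Lemma moves_act (g : SF) k n : g =1 act k -> moves g n <-> 0 < n /\ ~~ (n %| k n).
Proof.
move=> gk; rewrite /moves gk; case: n => [|n].
  by rewrite /act pickleK_inv; split => // -[].
rewrite actE// add0n; split => [kn|[_ /negP nk] /(pcan_inj pickleK)[]].
  by split => //; apply/negP => /eqP kn0; apply: kn; rewrite kn0.
by move=> /eqP.
Qed.

(** A copy of the direct sum of the cyclic groups of order [n], for positive [n] in [C]. *)
Definition Phi_set (C : set nat) : set SF :=
  [set g : SF | exists k, [/\ exists N, bounded_by N k, g =1 act k & moves g `<=` C]].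

Lemma Phi_subgroup C : is_subgroup (Phi_set C).
Proof.
split.
- exists (fun=> 0); split; [by exists 0|by move=> x; rewrite act_id|].
  by move=> n [].
- move=> g h [k [[N kN] gk gC]] [l [[M lM] hl hC]].
  exists (fun n => k n + l n); split.
  + exists (maxn N M) => n; rewrite geq_max => /andP[Nn Mn].
    by rewrite kN// lM.
  + by move=> x; rewrite -act_comp -gk -hl.
  + move=> n ghn; have [hn|] := pselect (moves h n); first exact: hC.
    move=> /contrapT hn; apply: gC => gn; apply: ghn.
    by rewrite /moves /= hn.
- move=> g [k [[N kN] gk gC]]; exists (fun n => n.-1 * k n); split.
  + by exists N => n /kN ->; rewrite muln0.
  + move=> x; apply: (can_inj (fun_funK g)); rewrite [LHS]fun_invK gk act_comp.
    by rewrite act_id// => -[//|n _]; rewrite /= -mulSn dvdn_mulr.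
  + move=> n gVn; apply: gC => gn; apply: gVn.
    by rewrite /moves /= -[X in fun_inv _ X]gn fun_funK.
Qed.

Definition Phi (C : set nat) : LF := MkLF (asboolT (Phi_subgroup C)).

Lemma Phi_sub B C : B `<=` C -> Phi_set B `<=` Phi_set C.
Proof. by move=> BC g [k [? ? gB]]; exists k; split => // n /gB/BC. Qed.

(** Continuity of [Phi]: an element of [Phi_set setT] moves only blocks below some [N], and any
    other [g] is never a member. *)
Lemma Phi_local g : exists N, forall B C, (forall n, n < N -> B n <-> C n) ->
  Phi_set B g <-> Phi_set C g.
Proof.
have [[k [[N kN] gk _]]|ng] := pselect (Phi_set setT g); last first.
  by exists 0 => B C _; split => /(Phi_sub (@subsetT _ _))/ng.
exists N; suff sub B C : (forall n, n < N -> B n <-> C n) -> Phi_set B g -> Phi_set C g.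
  by move=> B C BC; split; apply: sub => // n /BC ->.
move=> BC [l [lb gl gB]]; exists k; split => //; first by exists N.
move=> n gn; apply/BC; last exact: gB.
rewrite ltnNge; apply/negP => Nn; move/(moves_act _ gk): gn => [_].
by rewrite kN// dvdn0.
Qed.

Lemma finite_Phi_bound (A : set SF) : finite_set A -> A `<=` Phi_set setT ->
  exists N, forall g n, A g -> moves g n -> n < N.
Proof.
move=> /finite_seqP[s ->] {A}; elim: s => [|g s IHs] sT; first by exists 0.
have [|N Ns] := IHs; first by move=> h hs; apply: sT; rewrite /= inE hs orbT.
have [k [[M kM] gk _]] := sT g (mem_head _ _).
exists (maxn N M) => h n; rewrite /= inE leq_max => /predU1P[->|hs] hn.
  have [|Mn] := ltnP n M; first by rewrite orbT.
  move/(moves_act _ gk): hn => [_].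
  by rewrite kM// dvdn0.
by rewrite (Ns h).
Qed.

Definition one_rot (p m n : nat) : nat := if n == p then m else 0.

Lemma one_rot_bounded p m : bounded_by p.+1 (one_rot p m).
Proof. by move=> n pn; rewrite /one_rot; case: eqVneq pn => // ->; rewrite ltnn. Qed.

Definition prime_set : set nat := [set n | prime n].

Lemma infinite_Phi C : C `<=` prime_set -> unbounded C -> infinite_set (Phi_set C).
Proof.
move=> Cp uC /finite_Phi_bound[|N Nb]; first exact: Phi_sub.
have [p Np Cp'] := uC N; have pp := Cp p Cp'.
pose g := rot (@one_rot_bounded p 1).
have gE : g =1 act (one_rot p 1) by [].
have gp : moves g p.
  by apply/(moves_act _ gE); rewrite /one_rot eqxx prime_gt0// dvdn1 gtn_eqF// prime_gt1.
have gC : Phi_set C g.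
  exists (one_rot p 1); split => //; first by exists p.+1; exact: one_rot_bounded.
  move=> n /(moves_act _ gE)[_]; rewrite /one_rot.
  by case: eqVneq => [->//|_]; rewrite dvdn0.
by have := Nb g p gC gp; rewrite ltnNge Np.
Qed.

(** If [C] lies below [N], all supports lie in the finite set [blocks N], which leaves finitely many
    permutations. *)
Lemma unbounded_Phi C : infinite_set (Phi_set C) -> unbounded C.
Proof.
move=> iC; apply: contrapT => /unboundedNP[N NC]; apply: iC.
apply: sub_finite_set (finite_supported (finite_blocks N)) => g [k [_ gk gC]] x /=.
rewrite /supp /fun_supp /= gk.
have [[n [j [jn ->]]]|->//] := block_or_fixed x.
rewrite actE// => nf; apply: blocks_mem => //; apply/NC/gC/(moves_act _ gk).
split; first exact: leq_ltn_trans jn.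
apply/negP => /eqP kn0; apply: nf.
by rewrite -modnDmr kn0 addn0 modn_small.
Qed.

Lemma subgroup_expg (G : LF) g m : LF_set G g -> LF_set G (g ^+ m)%g.
Proof.
have [G1 GM _] := LFP G; move=> Gg; elim: m => [|m IHm]; first by rewrite expg0.
by rewrite expgS; exact: GM.
Qed.

Lemma expg_act (g : SF) k m : g =1 act k -> (g ^+ m)%g =1 act (fun n => m * k n).
Proof.
move=> gk; elim: m => [|m IHm] x; first by rewrite expg0 act_id.
rewrite expgS (_ : (g * _)%g x = g ((g ^+ m)%g x))// IHm gk act_comp.
by apply: eq_act => n _; rewrite mulSn.
Qed.

(* By the Chinese remainder theorem, some power of [g] acts on block [p] as any
   prescribed rotation, and trivially on the other blocks. *)
Lemma isolate_rotation (G : LF) (g : SF) p m :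
  G `<=` Phi_set prime_set -> LF_set G g -> moves g p ->
  exists2 h : SF, LF_set G h & h =1 act (one_rot p m).
Proof.
move=> GP Gg gp; have [k [[N kN] gk gP]] := GP g Gg.
have pp : prime p by exact: gP.
have [p0 /negP pk] := (moves_act _ gk).1 gp.
(* The factor [M] kills the rotations of the other prime blocks. Below, [a] inverts [M * k p] modulo
   [p], whence the exponent [m * a * M]. *)
pose M := \prod_(n < N | prime n && (n != p :> nat)) n.
have cop : coprime (M * k p) p.
  rewrite coprimeMl; apply/andP; split; last first.
    by rewrite coprime_sym prime_coprime//; exact/negP.
  rewrite /M; elim/big_ind: _ => [|x y xp yp|n /andP[pn np]].
  - exact: coprime1n.
  - by rewrite coprimeMl xp.
  - by rewrite prime_coprime// dvdn_prime2.
have M0 : 0 < M * k p.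
  rewrite lt0n; apply/eqP => M0; move: cop; rewrite M0 /coprime gcd0n => /eqP p1.
  by rewrite p1 in pp.
have [[a b] /= ab] := coprimeP p M0 cop.
exists (g ^+ (m * a * M))%g; first exact: subgroup_expg.
move=> x; rewrite (expg_act _ gk); apply: eq_act => n n0; rewrite /one_rot.
case: eqVneq => [->|np].
  have {}ab : a * (M * k p) = b * p + 1 by rewrite -ab subnKC// ltnW// -subn_gt0 ab.
  by rewrite -mulnA -mulnA ab mulnDr muln1 mulnA modnMDl.
apply/eqP; rewrite mod0n -/(n %| _).
have [/kN ->|nN] := leqP N n; first by rewrite muln0.
have [pn|npn] := boolP (prime n).
  rewrite dvdn_mulr// dvdn_mull// /M (bigD1 (Ordinal nN)) ?pn//=.
  exact: dvdn_mulr.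
rewrite dvdn_mull//; apply: contrapT => /negP nk; apply: (negP npn).
by apply: gP; apply/(moves_act _ gk).
Qed.

(** The last block is peeled off: the component of [g] there belongs to [G] by [isolate_rotation] or
    is trivial, and the rest has a smaller bound. *)
Lemma subgroup_of_Phi (G : LF) : G `<=` Phi_set prime_set ->
  G = Phi [set n | exists2 g, LF_set G g & moves g n].
Proof.
move=> GP; have [G1 GM GV] := LFP G; set C := [set n | _].
apply/LF_ext/seteqP; split => [g Gg|g [k [[N kN] gk gC]]].
  have [k [kb gk _]] := GP g Gg; exists k; split => // n gn.
  by exists g.
elim: N k kN g gk gC => [|N IHN] k kN g gk gC.
  rewrite (_ : g = 1%g)//; apply: SF_ext => x.
  by rewrite gk act_id// => n _; rewrite kN.
pose k' n := if n == N then 0 else k n.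
have k'N : bounded_by N k'.
  move=> n; rewrite leq_eqVlt /k' => /predU1P[<-|Nn]; first by rewrite eqxx.
  by rewrite gtn_eqF// kN.
pose g' := rot k'N; have g'E : g' =1 act k' by [].
have Gg' : LF_set G g'.
  apply: (IHN _ k'N _ g'E) => n /(moves_act _ g'E)[n0 nk]; apply/gC/(moves_act _ gk).
  by split => //; apply: contra nk; rewrite /k'; case: eqP.
have [h Gh hE] : exists2 h : SF, LF_set G h & h =1 act (one_rot N (k N)).
  have [[h Gh hN]|nN] := pselect (C N); first exact: isolate_rotation hN.
  exists 1%g => // x; rewrite act_id// => n n0; rewrite /one_rot.
  case: eqVneq n0 => [-> N0|_ _]; last exact: dvdn0.
  by apply: contrapT => /negP nk; apply/nN/gC/(moves_act _ gk).
suff -> : g = (g' * h)%g by exact: GM.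
apply: SF_ext => x; rewrite (_ : (g' * h)%g x = g' (h x))// g'E hE act_comp gk.
apply: eq_act => n _; rewrite /k' /one_rot.
by case: eqVneq => [->|_]; rewrite ?addn0.
Qed.

(** The group induced on [supp g] decides membership of [g], and fixing it is an open condition.
    Failure at every [i] would give a sequence converging to [y] along which membership differs. *)
Lemma LF_continuous (f : baire_space -> LF) (y : baire_space) (g : SF) :
  continuous f -> exists i, forall z : baire_space,
    (forall j, j < i -> z j = y j) -> LF_set (f z) g <-> LF_set (f y) g.
Proof.
move=> cf; apply: contrapT => nex.
have /choice[z zP] : forall i, exists z : baire_space,
    (forall j, j < i -> z j = y j) /\ ~ (LF_set (f z) g <-> LF_set (f y) g).
  move=> i; apply: contrapT => nz; apply: nex; exists i => z zy.
  by apply: contrapT => nfz; apply: nz; exists z.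
have zcvg : z @ \oo --> y.
  apply/cvg_sup => N U [V] [[W] oW <-] WfN WU.
  apply: (filterS WU); rewrite nbhs_simpl; exists N.+1 => // i /= Ni.
  by rewrite (zP i).1.
pose HA := (Defs.induced (f y) (supp g), supp g).
have nU : nbhs (f y) (LF_base HA).
  apply: open_nbhs_nbhs; split => //.
  exists [set HA]; last by rewrite bigcup_set1.
  by move=> _ ->; apply: LF_base_index_induced; exact: (SFP g).2.
have [N _ /(_ N (leqnn N)) /= fzN] := zcvg _ (cf y _ nU).
case: (zP N) => _; apply.
have e : LF_set (Defs.induced (f (z N)) (supp g)) g <-> LF_set (Defs.induced (f y) (supp g)) g.
  by rewrite (fzN : Defs.induced _ _ = _).
by split => fg; [have [] := e.1 (conj fg (@subset_refl _ _))|
                 have [] := e.2 (conj fg (@subset_refl _ _))].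
Qed.

(** * Homogeneous subgroups *)

Lemma SF_code : exists c : SF -> seq nat, injective c.
Proof.
have /choice[N NP] : forall g : SF, exists N, forall n, N <= n -> g n = n.
  move=> g; have /finite_seqP[s gs] := (SFP g).2.
  exists (\max_(m <- s) m).+1 => n sn; apply: contrapT => gn.
  have : [set` s] n by rewrite -gs.
  rewrite /= => /(leq_bigmax_seq (P := xpredT) (F := id)) => /(_ isT).
  by rewrite leqNgt sn.
exists (fun g : SF => mkseq g (N g)) => g h gh; apply: SF_ext => n.
have Ngh : N g = N h by have := congr1 size gh; rewrite !size_mkseq.
have [Nn|nN] := leqP (N g) n; first by rewrite !NP -?Ngh.
by have := congr1 (nth 0 ^~ n) gh; rewrite !nth_mkseq -?Ngh.
Qed.

Lemma mkseq_eqP (y z : nat -> nat) i :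
  mkseq z i = mkseq y i <-> forall j, j < i -> z j = y j.
Proof.
split => [e j ji|zy]; first by have := congr1 (nth 0 ^~ j) e; rewrite !nth_mkseq.
by apply: (@eq_from_nth _ 0) => [|j]; rewrite !size_mkseq// => ji; rewrite !nth_mkseq// zy.
Qed.

(** Bounds the number of nonempty analytic sets by the continuum: each [g] in [f y] is forced by a
    finite piece of [y], so the pairs of such a piece and [g] determine [f]. *)
Lemma continuous_code : exists code : (baire_space -> LF) -> set nat,
  forall f f', continuous f -> continuous f' -> code f = code f' -> f = f'.
Proof.
have [c cinj] := SF_code.
pose code (f : baire_space -> LF) : set nat :=
  [set k | exists t g, k = pickle (t, c g) /\
     forall z : baire_space, mkseq z (size t) = t -> LF_set (f z) g].
exists code.
suff sub f f' : continuous f -> code f = code f' -> forall y, f y `<=` f' y.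
  move=> f f' cf cf' ff'; apply/funext => y; apply/LF_ext/seteqP.
  by split; apply: sub.
move=> cf ff' y g fyg; have [i fi] := LF_continuous y g cf.
have : code f (pickle (mkseq y i, c g)).
  exists (mkseq y i), g; split => // z; rewrite size_mkseq => /mkseq_eqP zy.
  exact/fi.
rewrite ff' => -[t [g' [/(pcan_inj pickleK)[<- /cinj <-] f'z]]].
by apply: f'z; rewrite size_mkseq.
Qed.

Definition homogeneous (Y : set LF) (B : set nat) :=
  (forall C, C `<=` B -> unbounded C -> ~ Y (Phi C)) \/
  (forall C, C `<=` B -> unbounded C -> Y (Phi C)).

(** The Souslin scheme of [range f] is pulled back along [Phi]. In the second alternative [f y]
    equals [Phi C], since membership of each [g] depends on finitely much of [y] and of [C]. *)
Lemma homogeneous_range (f : baire_space -> LF) A : continuous f -> unbounded A ->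
  exists2 B, B `<=` A & unbounded B /\ homogeneous (range f) B.
Proof.
move=> cf uA.
pose X (t : seq nat) (C : set nat) :=
  exists2 z : baire_space, mkseq z (size t) = t & f z = Phi C.
have XS t C : X t C -> exists m, X (rcons t m) C.
  move=> [z zt fz]; exists (z (size t)); exists z => //.
  by rewrite size_rcons mkseqS zt.
have [B BA [uB [XB|XB]]] := souslin_ramsey XS uA; exists B => //; split => //.
  left => C CB uC [z _ fz]; apply: (XB C CB uC).
  by exists z.
right => C CB uC; have [y yX] := XB C CB uC; exists y => //.
suff fyC g : LF_set (f y) g <-> Phi_set C g.
  by apply/LF_ext/seteqP; split => g /fyC.
have [i fi] := LF_continuous y g cf; have [N NP] := Phi_local g.
have [D [z + fz] DC] := yX (maxn i N); rewrite size_mkseq => /mkseq_eqP zy.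
have DN n : n < N -> D n <-> C n.
  by move=> nN; apply: DC; rewrite leq_max nN orbT.
rewrite -(NP D C DN) -(fi z) ?fz// => j ji.
by apply: zy; rewrite leq_max ji.
Qed.

Lemma coloring_range (delta : LF -> bool) : Sigma11_Pi11_coloring delta ->
  exists Y : set LF, (Y = set0 \/ exists2 f : baire_space -> LF, continuous f & range f = Y) /\
    exists b, forall G, delta G = b <-> Y G.
Proof.
move=> /(_ true)[an|an].
  exists (delta @^-1` [set true]); split; first exact: an.
  by exists true.
exists (~` (delta @^-1` [set true])); split; first exact: an.
exists false => G; rewrite /preimage /setC /=.
by case: (delta G); split.
Qed.

Theorem theorem3p1 :
  Martin_Axiom ->
  exists F : set LF,
    [/\ lattice_filter F,
        F `<=` ~` IF &
        forall delta : LF -> bool, Sigma11_Pi11_coloring delta ->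
          exists2 G : LF, F G &
            forall H K : LF,
              infinite_set H -> (H <= G)%O -> infinite_set K -> (K <= G)%O ->
              delta H = delta K].
Proof.
move=> MA.
have [code code_inj] := continuous_code.
(* Stage [x] of the tower treats the at most one continuous [f] with code [x]. *)
pose D x B := forall f, continuous f -> code f = x -> homogeneous (range f) B.
have uprime : unbounded prime_set.
  by move=> n; have [p /ltnW np pp] := prime_above n; exists p.
have dnsD x : dense_below prime_set (D x).
  move=> A uA _.
  have [[f [cf fx]]|nf] := pselect (exists f, continuous f /\ code f = x).
    have [B BA [uB hB]] := homogeneous_range cf uA.
    exists B => //; split => // f' cf' f'x.
    by rewrite (code_inj f' f)// f'x.
  by exists A => //; split => // f cf fx; case: nf; exists f.
have [T [TP Tchain]] := generic_tower MA uprime dnsD.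
(* Tails are allowed because the tower decreases only modulo finite sets; this makes [F] closed
   under meets. *)
pose F : set LF := [set G : LF | exists x n, Phi_set (from n (T x)) `<=` G].
have FT x : F (Phi (T x)).
  by exists x, 0; apply: Phi_sub; exact: from_sub.
exists F; split.
- split.
  + by exists (Phi (T set0)).
  + move=> G H [x [n xG]] /LF_leP GH; exists x, n; exact: subset_trans GH.
  + have FI (G H : LF) x y n m : almost_sub (T x) (T y) -> Phi_set (from n (T x)) `<=` G ->
        Phi_set (from m (T y)) `<=` H -> F (G `&` H)%O.
      move=> [k kxy] xG yH; exists x, (maxn n (maxn k m)) => g Tg; split.
        apply: xG; apply: Phi_sub Tg => i [Ti]; rewrite geq_max => /andP[ni _].
        by split.
      apply: yH; apply: Phi_sub Tg => i [Ti].
      rewrite !geq_max => /and3P[_ ki mi]; split => //; exact: kxy.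
    move=> G H [x [n xG]] [y [m yH]]; have [xy|yx] := Tchain x y.
      exact: FI xy xG yH.
    by rewrite (_ : (G `&` H)%O = (H `&` G)%O); [exact: FI yx yH xG|apply/LF_ext; exact: setIC].
- move=> G [x [n xG]] fG; have [uT Tp _] := TP x.
  apply: (@infinite_Phi (from n (T x))); last exact: (sub_finite_set xG fG).
    by move=> p [/Tp].
  exact: from_unbounded.
move=> delta /coloring_range[Y [Yf [b Yb]]].
have [x hx] : exists x, homogeneous Y (T x).
  case: Yf => [->|[f cf <-]]; first by exists set0; left => C _ _ [].
  by exists (code f); have [_ _] := TP (code f); apply.
exists (Phi (T x)) => // H K iH /LF_leP HT iK /LF_leP KT.
(* This reduces infinite subgroups of [Phi (T x)] to the sets about which homogeneity speaks. *)
have HC (G : LF) : infinite_set G -> G `<=` Phi_set (T x) ->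
    exists C, [/\ C `<=` T x, unbounded C & G = Phi C].
  move=> iG GT; have GE : G = Phi [set n | exists2 g, LF_set G g & moves g n].
    apply: subgroup_of_Phi; apply: subset_trans GT _.
    by have [_ Tp _] := TP x; exact: Phi_sub.
  eexists; split; last exact: GE.
    by move=> n [g /GT[k [_ _ gT]] /gT].
  by apply: unbounded_Phi; rewrite GE in iG.
have [C [CT uC ->]] := HC H iH HT; have [C' [CT' uC' ->]] := HC K iK KT.
have YCC' : Y (Phi C) <-> Y (Phi C').
  by case: hx => hx; split => ?; [case: (hx C)|case: (hx C')|exact: hx|exact: hx].
have {Yb} := conj (Yb (Phi C)) (Yb (Phi C')).
by case: (delta (Phi C)) (delta (Phi C')) b => [] [] []; intuition.
Qed.
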